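(* Let $G$ be a compact group with identity component $G^\circ$, and let $L$ and $K$ be finite-dimensional continuous real $G$-representations, each endowed with a $G$-invariant inner product. Set \[ V:=L^{G^\circ},\qquad W:=V^\perp\subseteq L,\qquad U:=K^{G^\circ},\qquad Z:=U^\perp\subseteq K, \] and let $P_U\colon K\to U$ and $P_Z\colon K\to Z$ be the orthogonal projections. Then the map \[ \operatorname{Hom}^{\mathrm{pl}}_G(L,K)\longrightarrow \operatorname{Hom}^{\mathrm{pl}}_G(V,U)\oplus\operatorname{Hom}_G(W,Z),\qquad F\longmapsto \bigl(P_U\circ F|_V,\; P_Z\circ F|_W\bigr) \] is (well defined and) an isomorphism of real vector spaces.
   Context: A representation of $G$ on a finite-dimensional real vector space $L$ is a continuous group homomorphism $\rho_L\colon G\to \operatorname{GL}(L)$. For a subgroup $H\le G$, $L^H:=\{v\in L:\rho_L(h)v=v \text{ for all } h\in H\}$. The subspace $L^{G^\circ}$ and its orthogonal complement are $G$-invariant, hence $G$-representations. A map $\Phi\colon L\to K$ is $G$-equivariant if $\rho_K(g)\Phi(l)=\Phi(\rho_L(g)l)$ for all $g\in G$, $l\in L$. $\operatorname{Hom}_G(L,K)$ is the vector space of $G$-equivariant linear maps $L\to K$. A convex polyhedral subset of a finite-dimensional real vector space $V$ is an intersection of finitely many closed affine half-spaces (possibly none). A map $f\colon V\to W$ between finite-dimensional real vector spaces is piecewise linear if there are finitely many convex polyhedral subsets $A_1,\dots,A_m$ with $V=\bigcup_i A_i$ such that for every $i$ there are a linear map $M_i\colon V\to W$ and $b_i\in W$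 with $f(x)=M_i(x)+b_i$ for all $x\in A_i$. $\operatorname{Hom}^{\mathrm{pl}}_G(L,K)$ is the vector space (under pointwise operations) of $G$-equivariant piecewise linear maps $L\to K$. *)

(* Defs.v *)
From HB Require Import structures.
From mathcomp Require Import all_boot all_order all_algebra.
From mathcomp Require Import all_classical all_reals all_analysis.

Set Implicit Arguments.
Unset Strict Implicit.
Unset Printing Implicit Defensive.

Import Order.TTheory GRing.Theory Num.Theory.
Import numFieldNormedType.Exports.
Import passmx.

Local Open Scope classical_set_scope.
Local Open Scope ring_scope.

(* Separation is not assumed. *)
HB.mixin Record Group_isTopologicalGroup G of Group G & Topological G := {
  mulg_continuous : continuous (fun gh : G * G => (gh.1 * gh.2)%g);
  invg_continuous : continuous (fun g : G => g^-1%g)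
}.

#[short(type="topologicalGroupType")]
HB.structure Definition TopologicalGroup :=
  {G of Group G & Topological G & Group_isTopologicalGroup G}.

Definition identity_component (G : topologicalGroupType) : set G :=
  connected_component [set: G] 1%g.

Arguments identity_component : clear implicits.

Section Representations.
Variables (R : realType) (G : topologicalGroupType).

(* [End(L)] carries the topology of real matrices, through the coordinates in
   some basis of [L] (the topology does not depend on which one).  The first
   two axioms force [rho g] to be invertible, and [GL(L)] has the topology
   induced from [End(L)]. *)
Record representation (L : vectType R) := Representation {
  rho :> G -> 'End(L);
  rho1 : rho 1%g = \1%VF;
  rhoM : forall g h : G, rho (g * h)%g = (rho g \o rho h)%VF;
  rho_continuous :
    continuous (fun g : G => mxof (vbasis {:L}) (vbasis {:L}) (rho g))
}.

Definition rep_stable (L : vectType R) (r : representation L) (V : {vspace L}) :=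
  forall g v, v \in V -> r g v \in V.

Lemma linear_mx_continuous (m n p q : nat)
  (f : {linear 'M[R]_(m, n) -> 'M[R]_(p, q)}) : continuous f.
Proof.
have sum_cont (T : topologicalType) (I : Type) (s : seq I) (F : I -> T -> R) :
    (forall k, continuous (F k)) -> continuous (fun x => \sum_(k <- s) F k x).
  move=> cF x; elim: s => [|k s ih].
    by under eq_fun do rewrite big_nil; exact: cst_continuous.
  under eq_fun do rewrite big_cons.
  by apply: cvgD; [exact: cF|exact: ih].
have mul_cont (T : topologicalType) (h : T -> R) (c : R) :
    continuous h -> continuous (fun x => h x * c).
  by move=> ch x; apply: cvgMr_tmp; exact: ch.
have fE i j : continuous (fun A : 'M[R]_(m, n) => f A i j).
  have -> : (fun A : 'M[R]_(m, n) => f A i j) =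
      (fun A => \sum_k \sum_l A k l * f (delta_mx k l) i j).
    apply/funext => A; rewrite {1}[A]matrix_sum_delta linear_sum summxE.
    apply: eq_bigr => k _; rewrite linear_sum summxE.
    by apply: eq_bigr => l _; rewrite linearZ mxE.
  apply: (sum_cont) => k; apply: (sum_cont) => l.
  by apply: mul_cont; exact: coord_continuous.
move=> A B [P PfA PB].
have PA (i : 'I_p) (j : 'I_q) : nbhs A [set M | P i j (f M i j)].
  exact: fE (PfA i j).
have PAll : nbhs A [set M | forall i j, P i j (f M i j)].
  apply: (@filter_forall _ _ _ _ (nbhs_filter A)) => i.
  by apply: (@filter_forall _ _ _ _ (nbhs_filter A)) => j; exact: PA.
apply: (@filterS _ _ (nbhs_filter A) _ _ _ PAll) => M HM; exact: PB.
Qed.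

Section SubRepresentation.
Variables (L : vectType R) (r : representation L) (V : {vspace L}).
Hypothesis stV : rep_stable r V.

Let subrho (g : G) : 'End(subvs_of V) := (linfun (vsproj V) \o r g \o linfun vsval)%VF.

Let subrhoE g v : vsval (subrho g v) = r g (vsval v).
Proof. by rewrite /subrho !comp_lfunE !lfunE/= vsprojK// stV// subvsP. Qed.

Let subrho1 : subrho 1%g = \1%VF.
Proof. by apply/lfunP => v; apply: val_inj; rewrite /= subrhoE rho1 !lfunE. Qed.

Let subrhoM (g h : G) : subrho (g * h)%g = (subrho g \o subrho h)%VF.
Proof.
by apply/lfunP => v; apply: val_inj; rewrite /= comp_lfunE !subrhoE rhoM comp_lfunE.
Qed.

Let subrho_continuous : continuous
  (fun g : G => mxof (vbasis {:subvs_of V}) (vbasis {:subvs_of V}) (subrho g)).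
Proof.
pose bL := vbasis {:L}; pose bV := vbasis {:subvs_of V}.
pose T (h : 'End(L)) : 'End(subvs_of V) := (linfun (vsproj V) \o h \o linfun vsval)%VF.
pose T' (A : 'M[R]_(\dim {:L})) := mxof bV bV (T (hommx bL bL A)).
have T'l : linear T'.
  have TE a h k : T (a *: h + k) = a *: T h + T k.
    by apply/lfunP => v; do !rewrite ?comp_lfunE ?add_lfunE ?scale_lfunE ?linearP.
  move=> a A B; rewrite /T' (_ : hommx _ _ _ = a *: hommx bL bL A + hommx bL bL B).
    by rewrite TE linearP.
  exact: linearP.
pose T'L := HB.pack_for {linear 'M[R]_(\dim {:L}) -> 'M[R]_(\dim {:subvs_of V})}
  T' (GRing.isLinear.Build R _ _ _ T' T'l).
have -> : (fun g : G => mxof bV bV (subrho g)) = T'L \o (fun g => mxof bL bL (r g)).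
  by apply/funext => g /=; rewrite /T' mxofK// vbasisP.
move=> g; apply: continuous_comp; first exact: rho_continuous.
exact: linear_mx_continuous.
Qed.

Definition subrep : representation (subvs_of V) :=
  Representation subrho1 subrhoM subrho_continuous.

End SubRepresentation.

Lemma fixv_subproof (L : vectType R) (r : representation L) (H : set G) :
  exists V : {vspace L}, forall v, v \in V <-> (forall h, H h -> r h v = v).
Proof.
pose fixes (V : {vspace L}) := forall v, v \in V -> forall h, H h -> r h v = v.
pose P n := `[< exists2 V, fixes V & \dim V = n >].
have [] := @ex_maxnP P (\dim {:L}).
- exists 0%N; apply/asboolP; exists 0%VS; last exact: dimv0.
  by move=> v; rewrite memv0 => /eqP -> h _; rewrite linear0.
- by move=> n /asboolP[V _ <-]; rewrite dimvS// subvf.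
move=> n /asboolP[V fV <-] maxV; exists V => v; split; first exact: fV.
move=> fv; have fVv : fixes (V + <[v]>)%VS.
  move=> _ /memv_addP[u uV [_ /vlineP[k ->] ->]] h Hh.
  by rewrite linearD linearZ /= (fV _ uV)// fv.
have le : (\dim (V + <[v]>) <= \dim V)%N by apply: maxV; apply/asboolP; exists (V + <[v]>)%VS.
have /eqP -> : V == (V + <[v]>)%VS by rewrite eqEdim addvSl.
by rewrite (subvP (addvSr _ _))// memv_line.
Qed.

Definition fixv (L : vectType R) (r : representation L) (H : set G) :
  {vspace L} := projT1 (cid (fixv_subproof r H)).

Lemma fixvP (L : vectType R) (r : representation L) (H : set G) (v : L) :
  v \in fixv r H <-> (forall h, H h -> r h v = v).
Proof. exact: projT2 (cid (fixv_subproof r H)) v. Qed.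

Lemma fixv_stable (L : vectType R) (r : representation L) :
  rep_stable r (fixv r (identity_component G)).
Proof.
move=> g v /fixvP fv; apply/fixvP => h hG0.
pose c (x : G) := (g^-1 * (x * g))%g.
have mulc (f k : G -> G) : continuous f -> continuous k ->
    continuous (fun x => (f x * k x)%g).
  move=> cf ck x; apply: (@cvg_comp _ _ _ (fun x => (f x, k x))
    (fun p : G * G => (p.1 * p.2)%g) _ (nbhs (f x, k x))).
    exact: cvg_pair (cf x) (ck x).
  exact: mulg_continuous (f x, k x).
have cc : continuous c.
  by apply: (mulc); [|apply: (mulc)] => x; [exact: cvg_cst|exact: cvg_id|exact: cvg_cst].
have cG0 : identity_component G (c h).
  have : (c @` identity_component G) `<=` identity_component G.
    apply: connected_component_max => //.
    - exists 1%g; first exact: connected_component_refl.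
      by rewrite /c mul1g mulVg.
    - apply: connected_continuous_connected; first exact: component_connected.
      exact: continuous_subspaceT.
  by apply; exists h.
rewrite -[in RHS](fv _ cG0) -!comp_lfunE -!rhoM /c.
by rewrite mulgA mulgV mul1g.
Qed.

(* [{dot L for idfun}]: symmetric positive definite bilinear forms on [L]. *)
Definition dot_invariant (L : vectType R) (r : representation L)
    (d : {dot L for idfun}) :=
  forall g u v, d (r g u) (r g v) = d u v.

Lemma orthov_stable (L : vectType R) (r : representation L)
    (d : {dot L for idfun}) (V : {vspace L}) :
  dot_invariant r d -> rep_stable r V -> rep_stable r (orthov d V).
Proof.
move=> inv stV g w wV; apply/mem_orthovP => v vV.
have E : d (r g w) v = d w (r g^-1%g v).
  by rewrite -(inv g^-1%g (r g w) v) -comp_lfunE -rhoM mulVg rho1 id_lfunE.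
rewrite [LHS]E.
by move/mem_orthovP: wV; apply; exact: stV.
Qed.

Definition equivariant (L K : vectType R) (rL : representation L)
    (rK : representation K) (F : L -> K) :=
  forall g l, rK g (F l) = F (rL g l).

End Representations.

Arguments fixv_stable {R G L} r.

Section OrthogonalProjection.
Variables (R : realType) (K : vectType R) (d : {dot K for idfun}).

(* [daddv_pi U V] projects onto [U] along [V]. *)
Definition orthproj (U : {vspace K}) (x : K) : subvs_of U :=
  vsproj U (daddv_pi U (orthov d U) x).

Lemma orthprojP (U : {vspace K}) (x : K) :
  x - vsval (orthproj U x) \in orthov d U.
Proof.
have cap0 : (U :&: orthov d U = 0)%VS.
  apply/eqP; rewrite -subv0; apply/subvP => u; rewrite memv_cap => /andP[uU].
  move=> /mem_orthovP /(_ u uU) duu; rewrite memv0; apply/negP => /negP u0.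
  by have := @neq0_dnorm_gt0 _ _ _ d u u0; rewrite [X in 0 < X]duu ltxx.
pose f := fun y : K => \row_(i < \dim U) d y (vbasis U)`_i.
have fl : linear f.
  by move=> a y z; apply/rowP => i; rewrite !mxE linearPl.
pose fL := HB.pack_for {linear K -> 'rV[R]_(\dim U)} f
  (GRing.isLinear.Build R _ _ _ f fl).
have kerE : (lker (linfun fL) <= orthov d U)%VS.
  apply/subvP => y; rewrite memv_ker lfunE /= => /eqP/rowP fy0.
  apply/mem_orthovP => v vU; rewrite (coord_vbasis vU) linear_sumr big1// => i _.
  by rewrite linearZr /=; have := fy0 i; rewrite !mxE => ->; rewrite mulr0.
have full : (U + orthov d U)%VS = fullv.
  apply/eqP; rewrite eqEdim subvf /= dimv_disjoint_sum//.
  rewrite -(limg_ker_dim (linfun fL) fullv) capfv addnC leq_add//.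
    by rewrite (leq_trans (dimvS (subvf _)))// dimvf /dim /= mul1n.
  exact: dimvS.
rewrite /orthproj vsprojK ?memv_pi//.
rewrite -{1}(@daddv_pi_add _ _ _ _ x cap0) ?full ?memvf//.
by rewrite addrC addKr memv_pi.
Qed.

End OrthogonalProjection.

Section PiecewiseLinear.
Variable R : realType.

Definition closed_halfspace (V : vectType R) (phi : 'Hom(V, R^o)) (c : R) :
  set V := [set x | (phi x : R) <= c].

(* The half-spaces are indexed by [s]; the nonzero linear forms are what makes
   them genuine half-spaces. *)
Definition polyhedral (V : vectType R) (A : set V) :=
  exists2 s : seq ('Hom(V, R^o) * R), (forall p, p \in s -> p.1 != 0) &
    A = \bigcap_(p in [set` s]) closed_halfspace p.1 p.2.

Definition piecewise_linear (V W : vectType R) (f : V -> W) :=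
  exists (m : nat) (A : 'I_m -> set V),
    [/\ forall i, polyhedral (A i), \bigcup_i A i = [set: V] &
      forall i, exists (M : 'Hom(V, W)) (b : W),
        forall x, A i x -> f x = M x + b].

Lemma polyhedralI (V : vectType R) (A B : set V) :
  polyhedral A -> polyhedral B -> polyhedral (A `&` B).
Proof.
move=> [s s0 ->] [t t0 ->]; exists (s ++ t).
  by move=> p; rewrite mem_cat => /orP[/s0|/t0].
apply/seteqP; split=> [x [sx tx] p /=|x stx].
  by rewrite mem_cat => /orP[/sx|/tx].
by split=> p /= ps; apply: stx; rewrite /= mem_cat ps ?orbT.
Qed.

Lemma piecewise_linear_lfun (V W : vectType R) (M : 'Hom(V, W)) :
  piecewise_linear M.
Proof.
exists 1%N, (fun=> setT); split.
- by move=> _; exists [::] => //; apply/seteqP; split.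
- by apply/seteqP; split => // x _; exists ord0.
- by move=> _; exists M, 0 => x _; rewrite addr0.
Qed.

Lemma piecewise_linearP (V W : vectType R) (a : R) (f g : V -> W) :
  piecewise_linear f -> piecewise_linear g -> piecewise_linear (a *: f + g).
Proof.
move=> [m [A [pA covA fA]]] [n [B [pB covB gB]]].
exists #|{: 'I_m * 'I_n}|,
  (fun k => A (enum_val k).1 `&` B (enum_val k).2); split.
- by move=> k; exact: polyhedralI.
- apply/seteqP; split=> // x _.
  have [i _ Ax] : (\bigcup_i A i) x by rewrite covA.
  have [j _ Bx] : (\bigcup_i B i) x by rewrite covB.
  by exists (enum_rank (i, j)) => //; rewrite enum_rankK.
- move=> k; have [M [b fE]] := fA (enum_val k).1.
  have [N [c gE]] := gB (enum_val k).2.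
  exists (a *: M + N), (a *: b + c) => x [Ax Bx].
  rewrite !fctE /= fE// gE// add_lfunE scale_lfunE scalerDr.
  by rewrite addrACA.
Qed.

End PiecewiseLinear.

Section HomSpaces.
Variables (R : realType) (G : topologicalGroupType) (L K : vectType R).
Variables (rL : representation G L) (rK : representation G K).

Definition equivariant_pl : {pred L -> K} :=
  fun F => `[< equivariant rL rK F /\ piecewise_linear F >].

Lemma equivariant_pl_submod : submod_closed equivariant_pl.
Proof.
split=> [|a f g /asboolP[ef pf] /asboolP[eg pg]]; apply/asboolP; split.
- by move=> h l; rewrite /= linear0.
- have -> : (0 : L -> K) = (0 : 'Hom(L, K)) by apply/funext => x; rewrite lfunE.
  exact: piecewise_linear_lfun.
- move=> h l; change (rK h (a *: f l + g l) = a *: f (rL h l) + g (rL h l)).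
  by rewrite linearP /= ef eg.
- exact: piecewise_linearP.
Qed.

HB.instance Definition _ :=
  GRing.isSubmodClosed.Build R (L -> K) equivariant_pl equivariant_pl_submod.

Record homPL := HomPL {
  homPL_fun :> L -> K;
  homPL_subproof : homPL_fun \in equivariant_pl
}.

HB.instance Definition _ := [isSub for homPL_fun].
HB.instance Definition _ := [Choice of homPL by <:].
HB.instance Definition _ := [SubChoice_isSubLmodule of homPL by <:].

Definition equivariant_linear : {pred 'Hom(L, K)} :=
  fun f => `[< equivariant rL rK f >].

Lemma equivariant_linear_submod : submod_closed equivariant_linear.
Proof.
split=> [|a f g /asboolP ef /asboolP eg]; apply/asboolP => h l.
  by rewrite !lfunE /= linear0.
by rewrite !(add_lfunE, scale_lfunE) linearP /= ef eg.
Qed.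

HB.instance Definition _ :=
  GRing.isSubmodClosed.Build R 'Hom(L, K) equivariant_linear
    equivariant_linear_submod.

Record homG := HomG {
  homG_lfun :> 'Hom(L, K);
  homG_subproof : homG_lfun \in equivariant_linear
}.

HB.instance Definition _ := [isSub for homG_lfun].
HB.instance Definition _ := [Choice of homG by <:].
HB.instance Definition _ := [SubChoice_isSubLmodule of homG by <:].

End HomSpaces.

(* Main.v *)
(* Where [F] is affine, [F x = M x + b] on a set with interior, equivariance under
   the elements [g] close to 1 gives [M g = g M] and [g b = b]; these [g] generate
   an open subgroup, so both identities hold on the identity component [G0].
   Hence [b] lies in [U], and [M] maps [V] to [U] and [W] to [Z].
   So along [W] the [U]-component of [F] takes finitely many values and is
   constant.  The [Z]-component is given by finitely many linear maps [N i]; a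
   difference [N i - N j] of rank 1 would have as image a line of [Z] on which
   [G0] acts by signs, hence trivially, contradicting the definition of [Z].
   The kernels of the nonzero differences thus have codimension at least 2 and
   do not disconnect [L], so all pieces use the same [N i], which vanishes on [V]
   because it maps [V] to both [U] and [Z]. *)
Require Import Defs.
From HB Require Import structures.
From mathcomp Require Import all_boot all_order all_algebra.
From mathcomp Require Import all_classical all_reals all_analysis.

Set Implicit Arguments.
Unset Strict Implicit.
Unset Printing Implicit Defensive.

Import Order.TTheory GRing.Theory Num.Theory.
Import numFieldNormedType.Exports.
Import passmx.

Local Open Scope classical_set_scope.
Local Open Scope ring_scope.

(** Within [C], the complement of the agreement set of [h] with [g i] is the union of the agreement
    sets with the selections different from [g i], since these never meet [g i] on [C]. By
    finiteness both are closed, so agreement is clopen in [C]. *)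
Lemma connected_selection (T : topologicalType) (W : Type) (I : finType)
    (C : set T) (h : T -> W) (g : I -> T -> W) :
  connected C ->
  (forall i, closed [set t | h t = g i t]) ->
  (forall t, C t -> exists i, h t = g i t) ->
  (forall i j, g i = g j \/ forall t, C t -> g i t <> g j t) ->
  forall i t0 t, C t0 -> h t0 = g i t0 -> C t -> h t = g i t.
Proof.
move=> cC cl cov sep i t0 t Ct0 ht0 Ct.
pose E := [set s | h s = g i s].
suff CE : C `&` E = C by move: Ct; rewrite -[X in X _]CE => -[].
apply: cC; [by exists t0; split| |by exists E; [exact: cl|]].
pose D := \bigcup_(j in [set j | g i <> g j]) [set s | h s = g j s].
exists (~` D).
  by apply: closed_openC; apply: closed_bigcup => [|j _]; [exact: finite_finset|exact: cl].
apply/seteqP; split=> s [Cs hs]; split=> //.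
  move=> [j nij hsj]; case: (sep i j) => // /(_ s Cs).
  by rewrite -hs hsj.
have [j hsj] := cov s Cs; case: (pselect (g i = g j)) => [gij|nij].
  by rewrite /E /= gij.
by case: hs; exists j.
Qed.

(** * Finite exceptional sets on real lines, and generic vectors *)

Section Reals.
Variable R : realType.

Lemma notin_finite_set (B : set R) : finite_set B -> exists t, ~ B t.
Proof.
move=> /finite_seqP[s ->]; exists (1 + \sum_(x <- s) `|x|) => /=.
set b := 1 + _ => bs.
have : `|b| <= \sum_(x <- s) `|x| by rewrite (big_rem b)//= lerDl sumr_ge0.
by apply/negP; rewrite -ltNge (lt_le_trans _ (ler_norm _))// ltrDr.
Qed.

(** A finite set of reals is closed, so [S] is clopen in the connected line. This extends statements
    from generic points of a line to all of its points. *)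
Lemma closed_cofinite_setT (S : set R) :
  closed S -> finite_set (~` S) -> S = [set: R].
Proof.
move=> cS fS.
have /accessible_finite_set_closed/(_ _ fS) clC := hausdorff_accessible (@Rhausdorff R).
have cT : connected [set: R] by apply/connected_intervalP.
have [t /contrapT St] := notin_finite_set fS.
apply: cT; first by exists t.
- by exists S; [rewrite -[S]setCK; exact: closed_openC|rewrite setTI].
- by exists S; rewrite ?setTI.
Qed.

Lemma finite_subsingleton (T : Type) (B : set T) :
  (forall s t, B s -> B t -> s = t) -> finite_set B.
Proof.
move=> B1; case: (pselect (B !=set0)) => [[t Bt]|/set0P/negP/negPn/eqP ->] //.
by apply: (sub_finite_set _ (finite_set1 t)) => s Bs; exact: B1.
Qed.

Section Subspaces.
Variable V : vectType R.
Implicit Types (x y : V) (U : {vspace V}).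

Lemma finite_line_subspace x y U : y \notin U -> finite_set [set t | x + t *: y \in U].
Proof.
move=> yU; apply: finite_subsingleton => s t /= sU tU.
apply: contraNeq yU; rewrite -subr_eq0 => st.
have : (x + s *: y) - (x + t *: y) \in U by rewrite rpredB.
rewrite opprD addrACA subrr add0r -scalerBl => /(memvZ (s - t)^-1).
by rewrite scalerA mulVf// scale1r.
Qed.

(** If the vector [x] that avoids the other subspaces lies in [U], take [y] outside [U]: the points
    [y + t *: x] all stay outside [U], and only finitely many [t] are bad for the others. *)
Lemma notin_subspaces (s : seq {vspace V}) :
  (forall U, U \in s -> U != fullv) -> exists x, forall U, U \in s -> x \notin U.
Proof.
elim: s => [|U s ih] sV; first by exists 0.
have [W Ws|x xs] := ih; first by apply: sV; rewrite inE Ws orbT.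
have [xU|xU] := boolP (x \in U); last first.
  by exists x => W; rewrite inE => /predU1P[->|/xs].
have : ~~ (fullv <= U)%VS.
  by apply: contra (sV U _) => [fU|]; rewrite ?inE ?eqxx// eqEsubv subvf.
move=> /subvPn[y _ yU].
have [t ts] := @notin_finite_set (\bigcup_(W in [set` s]) [set t | y + t *: x \in W])
  (bigcup_finite (finite_seq s) (fun W Ws => @finite_line_subspace y x W (xs W Ws))).
exists (y + t *: x) => W; rewrite inE => /predU1P[->|Ws].
  by rewrite rpredDr ?memvZ.
by apply/negP => yx; apply: ts; exists W.
Qed.

End Subspaces.

(** Argued without a topology on [W]: the set is everything, empty, or finite. *)
Lemma closed_line_eq (W : vectType R) (u w : W) :
  closed [set t : R | u + t *: w = 0].
Proof.
have [->|w0] := eqVneq w 0.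
  rewrite (_ : [set _ | _] = if u == 0 then setT else set0).
    by case: ifP => _; [exact: closedT|exact: closed0].
  by apply/seteqP; split=> t; rewrite /= scaler0 addr0; case: eqP.
have /accessible_finite_set_closed := hausdorff_accessible (@Rhausdorff R).
apply; apply: (sub_finite_set _ (@finite_line_subspace W u w 0%VS _)).
  by move=> t /= ->; rewrite mem0v.
by rewrite memv0.
Qed.

(** * Systems of half-spaces and their restrictions to lines *)

Section Halfspaces.
Variable V : vectType R.
Implicit Types (s : seq ('Hom(V, R^o) * R)) (x y : V).

Definition inside s x := all (fun p : 'Hom(V, R^o) * R => (p.1 x : R) <= p.2) s.

(** Stands in for the interior of a piece, so that [V] needs no topology. *)
Definition strictly_inside s x := all (fun p : 'Hom(V, R^o) * R => (p.1 x : R) < p.2) s.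

Lemma strictly_insideW s x : strictly_inside s x -> inside s x.
Proof. by apply: sub_all => p /ltW. Qed.

Lemma insideE s :
  \bigcap_(p in [set` s]) closed_halfspace p.1 p.2 = [set x | inside s x].
Proof.
apply/seteqP; split=> x; first by move=> sx; apply/allP => p /sx.
by move=> /allP sx p /sx.
Qed.

Lemma closed_line_inside s x y : closed [set t : R | inside s (x + t *: y)].
Proof.
rewrite (_ : [set _ | _] = \bigcap_(p in [set` s])
    (fun t : R => (p.1 x : R) + t * (p.1 y : R)) @^-1` [set r | r <= p.2]).
  apply: closed_bigI => p _; apply: closed_comp; last exact: closed_le.
  by move=> t _; apply: cvgD; [exact: cvg_cst|apply: cvgM; [exact: cvg_id|exact: cvg_cst]].
apply/seteqP; split=> t.
  by move=> /allP st p /st /=; rewrite linearD linearZ.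
by move=> st; apply/allP => p /st /=; rewrite linearD linearZ.
Qed.

Lemma strictly_inside_line s x y :
  strictly_inside s x -> exists2 t : R, t != 0 & strictly_inside s (x + t *: y).
Proof.
move=> sx; have : \forall t \near (0 : R)^', strictly_inside s (x + t *: y).
  apply: nbhs_dnbhs; elim: s sx => [_|p s ih /= /andP[px /ih{}ih]].
    exact: filterE.
  have pc : (fun t : R => p.1 x + t * p.1 y : R) @ (0 : R) --> (p.1 x : R).
    rewrite -[X in _ --> X]addr0 -[X in _ --> _ + X](mul0r (p.1 y : R)).
    by apply: cvgD; [exact: cvg_cst|apply: cvgM; [exact: cvg_id|exact: cvg_cst]].
  near=> t => /=; apply/andP; split; last by near: t.
  by rewrite linearD linearZ; near: t; apply: (cvgr_lt _ pc) px.
move=> /(filterI (nbhs_dnbhs_neq (0 : R))) /filter_ex[t [t0 st]].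
by exists t.
Unshelve. all: by end_near. Qed.

End Halfspaces.

(** * Piecewise linear maps given by explicit affine pieces *)

Section Pieces.
Variables V W : vectType R.

Definition pl_pieces (F : V -> W) m (s : 'I_m -> seq ('Hom(V, R^o) * R))
    (M : 'I_m -> 'Hom(V, W)) (b : 'I_m -> W) :=
  [/\ forall i p, p \in s i -> p.1 != 0, forall x, exists i, inside (s i) x
    & forall i x, inside (s i) x -> F x = M i x + b i].

Lemma piecewise_linear_pieces (F : V -> W) : piecewise_linear F ->
  exists m (s : 'I_m -> seq ('Hom(V, R^o) * R)) M b, pl_pieces F s M b.
Proof.
move=> [m [A [pA cA FA]]]; exists m.
have /choice[s sP] : forall i, exists s : seq ('Hom(V, R^o) * R),
    (forall p, p \in s -> p.1 != 0) /\ A i = [set x | inside s x].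
  by move=> i; have [s s0 ->] := pA i; exists s; rewrite insideE.
have /choice[M MP] := FA; have /choice[b bP] := MP.
exists s, M, b; split.
- by move=> i p; exact: (sP i).1.
- move=> x; have [i _] : (\bigcup_i A i) x by rewrite cA.
  by rewrite (sP i).2 => Aix; exists i.
- by move=> i x sx; apply: bP; rewrite (sP i).2.
Qed.

(** Plays the role of continuity of [F] along lines: on each of the finitely many closed pieces the
    condition is an affine equation in [t]. *)
Lemma closed_line_pieces (F : V -> W) m (s : 'I_m -> _) M b x y u w :
  pl_pieces F s M b -> closed [set t : R | F (x + t *: y) = u + t *: w].
Proof.
move=> [_ cs FE].
rewrite (_ : [set _ | _] = \bigcup_i ([set t | inside (s i) (x + t *: y)] `&`
    [set t | (M i x + b i - u) + t *: (M i y - w) = 0])).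
  apply: closed_bigcup; first exact: finite_finset.
  by move=> i _; apply: closedI; [exact: closed_line_inside|exact: closed_line_eq].
have E i t : inside (s i) (x + t *: y) ->
    F (x + t *: y) = u + t *: w <-> (M i x + b i - u) + t *: (M i y - w) = 0.
  move=> /FE ->; rewrite linearD linearZ /= (addrAC (M i x)) scalerBr addrACA -opprD.
  by split=> [/eqP|/eqP]; [rewrite -subr_eq0|rewrite subr_eq0] => /eqP.
apply/seteqP; split=> t /=.
  by have [i si] := cs (x + t *: y) => Ft; exists i => //; split=> //=; apply/E.
by move=> [i _ [/= si]] /E; exact.
Qed.

(* On a generic line only finitely many points lie on a bounding hyperplane, and
   every other point is strictly inside the piece which contains it. *)
Lemma pl_pieces_fat (F : V -> W) m (s : 'I_m -> _) M b : pl_pieces F s M b ->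
  exists j : 'I_m -> 'I_m, (forall i, exists x, strictly_inside (s (j i)) x) /\
    pl_pieces F (s \o j) (M \o j) (b \o j).
Proof.
move=> [s0 cs FE].
pose fat i := exists x, strictly_inside (s i) x.
have cov x : exists2 i, fat i & inside (s i) x.
  pose ps := [seq p | i <- enum 'I_m, p <- s i].
  have psP i p : p \in s i -> p \in ps.
    by move=> pi; apply/allpairsPdep; exists i, p; rewrite mem_enum.
  (* The direction [y] lies in the kernel of no bounding form, so a line along [y] meets each
     bounding hyperplane at most once. *)
  have [U|y y_ps] := @notin_subspaces V [seq lker p.1 | p <- ps].
    move=> /mapP[p /allpairsPdep[i [q [_ qi ->]]] ->].
    apply: contra (s0 _ _ qi) => /eqP kq; apply/eqP/lfunP => z.
    by rewrite zero_lfunE; apply/eqP; rewrite -memv_ker kq memvf.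
  pose S := \bigcup_(i in fat) [set t | inside (s i) (x + t *: y)].
  (* The fat pieces cover the generic points of the line; their union is closed, so it also contains
     [x], the point at parameter 0. *)
  have ST : S = setT.
    apply: closed_cofinite_setT.
      apply: closed_bigcup; first exact: finite_finset.
      by move=> i _; exact: closed_line_inside.
    apply: (@sub_finite_set _ _
        (\bigcup_(p in [set` ps]) [set t | (p.1 (x + t *: y) : R) = p.2])).
      move=> t nSt; apply: contrapT => nt; apply: nSt.
      have [i si] := cs (x + t *: y); exists i => //.
      exists (x + t *: y); apply/allP => p pi.
      rewrite lt_neqAle (allP si _ pi) andbT; apply/eqP => pt.
      by apply: nt; exists p => //; exact: psP pi.
    apply: bigcup_finite => // p pps.
    apply: finite_subsingleton => t t' /= <-.
    rewrite !linearD !linearZ => /addrI/esym; apply: (@mulIf R (p.1 y)).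
    by have := y_ps (lker p.1) (map_f _ pps); rewrite memv_ker.
  have : S 0 by rewrite ST.
  by move=> [i fi]; rewrite /= scale0r addr0; exists i.
have [i0 fi0 _] := cov 0.
(* Thin pieces are replaced by copies of the fat piece [i0], which keeps the index set. *)
exists (fun i => if `[< fat i >] then i else i0); split.
  by move=> i; case: asboolP.
split=> [i p|x|i x]; [exact: s0| |exact: FE].
by have [i /asboolP fi si] := cov x; exists i; rewrite /= fi.
Qed.

End Pieces.

End Reals.

(** * Composition with linear maps, and rigidity of piecewise linear maps *)

Section PiecewiseLinearMaps.
Variable R : realType.

Lemma pl_pieces_lfun (V W X : vectType R) (Q : 'Hom(W, X)) (F : V -> W) m
    (s : 'I_m -> _) M b : pl_pieces F s M b ->
  pl_pieces (Q \o F) s (fun i => (Q \o M i)%VF) (Q \o b).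
Proof.
by move=> [s0 cs FE]; split=> // i x /FE /= ->; rewrite linearD comp_lfunE.
Qed.

(* A zero form gives either no condition or the empty set; the latter need not be
   polyhedral, so an empty piece is replaced by the one which contains [0]. *)
Lemma piecewise_linear_inside (V W : vectType R) (F : V -> W) m
    (s : 'I_m -> seq ('Hom(V, R^o) * R)) (M : 'I_m -> 'Hom(V, W)) b :
  (forall x, exists i, inside (s i) x) ->
  (forall i x, inside (s i) x -> F x = M i x + b i) -> piecewise_linear F.
Proof.
move=> cs FE; have [i0 i00] := cs 0.
pose j i := if `[< exists x, inside (s i) x >] then i else i0.
have jne i : exists x, inside (s (j i)) x.
  by rewrite /j; case: asboolP => // _; exists 0.
exists m, (fun i => [set x | inside (s (j i)) x]); split.
- move=> i; exists [seq p <- s (j i) | p.1 != 0].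
    by move=> p; rewrite mem_filter => /andP[].
  rewrite insideE; apply/seteqP; split=> x /allP sx; apply/allP => p ps.
    by apply: sx; move: ps; rewrite mem_filter => /andP[].
  have [p0|p0] := eqVneq p.1 0; last by apply: sx; rewrite mem_filter p0.
  have [y /allP/(_ p ps)] := jne i.
  by rewrite p0 !zero_lfunE.
- apply/seteqP; split=> // x _; have [i si] := cs x; exists i => //=.
  by rewrite /j; case: asboolP => // -[]; exists x.
- by move=> i; exists (M (j i)), (b (j i)) => x; exact: FE.
Qed.

(** Half-spaces are pulled back by composing their forms with [P]. This may produce zero forms,
    hence the appeal to [piecewise_linear_inside]. *)
Lemma piecewise_linear_comp (V' V W W' : vectType R) (P : 'Hom(V', V)) (F : V -> W)
    (Q : 'Hom(W, W')) :
  piecewise_linear F -> piecewise_linear (fun x => Q (F (P x))).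
Proof.
move=> /piecewise_linear_pieces[m [s [M [b [_ cs FE]]]]].
pose s' i := [seq ((p.1 \o P)%VF, p.2) | p <- s i].
have s'E i x : inside (s' i) x = inside (s i) (P x).
  by rewrite /inside all_map; apply: eq_all => p /=; rewrite comp_lfunE.
apply: (@piecewise_linear_inside _ _ _ _ s' (fun i => (Q \o M i \o P)%VF) (Q \o b)).
  by move=> x; have [i si] := cs (P x); exists i; rewrite s'E.
by move=> i x; rewrite s'E => /FE ->; rewrite linearD !comp_lfunE.
Qed.

Section Rigidity.
Variables (V W : vectType R) (F : V -> W) (m : nat).
Variables (s : 'I_m -> seq ('Hom(V, R^o) * R)) (M : 'I_m -> 'Hom(V, W)).

(* Along the line through [x] and [x + y], [F] is continuous with finitely many
   values. *)
Lemma pl_pieces_const b x y : pl_pieces F s M b ->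
  (forall i, M i y = 0) -> F (x + y) = F x.
Proof.
move=> pF My; have [_ cs FE] := pF.
have sel t : exists i, F (x + t *: y) = M i x + b i.
  by have [i /FE ->] := cs (x + t *: y); exists i; rewrite linearD linearZ /= My scaler0 addr0.
have [i Fi] := sel 0.
have cT : connected [set: R] by apply/connected_intervalP.
rewrite -[x in RHS]addr0 -(scale0r y) Fi -[y in LHS]scale1r.
apply: (@connected_selection R _ _ _ (fun t => F (x + t *: y))
  (fun i _ => M i x + b i) cT _ _ _ i 0 1 I Fi I) => //.
- move=> k; have := @closed_line_pieces _ _ _ _ _ _ _ _ x y (M k x + b k) 0 pF.
  by under eq_set do rewrite scaler0 addr0.
- move=> k l; have [->|kl] := eqVneq (M k x + b k) (M l x + b l); [by left|right].
  by move=> t _; apply/eqP.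
Qed.

(* The complement of the finitely many kernels [lker (M i - M j)], all of
   codimension at least 2, is connected by broken lines, and on it the piece in
   use cannot change. *)
Lemma pl_pieces_linear : pl_pieces F s M (fun=> 0) ->
  (forall i j, M i != M j -> forall x, (lker (M i - M j) + <[x]>)%VS != fullv) ->
  exists i, F =1 M i.
Proof.
move=> pF cod; have [_ cs FE] := pF.
pose ks := [seq lker (M ij.1 - M ij.2) | ij <- enum {: 'I_m * 'I_m} & M ij.1 != M ij.2].
have ksP i j : M i != M j -> lker (M i - M j) \in ks.
  by move=> nij; apply/mapP; exists (i, j) => //; rewrite mem_filter nij mem_enum.
have ks_cod U x : U \in ks -> (U + <[x]>)%VS != fullv.
  by move=> /mapP[[i j]]; rewrite mem_filter => /andP[nij _] ->; exact: cod.
have sel x : exists i, F x = M i x.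
  by have [i /FE ->] := cs x; exists i; rewrite addr0.
have [U|x0 gx0] := @notin_subspaces _ V ks.
  move=> /(ks_cod _ 0); apply: contra => /eqP ->.
  by rewrite eqEsubv subvf addvSl.
(* A point of the line through [x] and [z] lying in a kernel [U] would put [x] in [U] or [z] in [U +
   <[x]>]. So the line avoids all kernels, and distinct [M k] never agree on it. *)
have seg x z : (forall U, U \in ks -> x \notin U) ->
    (forall U, U \in ks -> z \notin (U + <[x]>)%VS) ->
    forall i, F x = M i x <-> F z = M i z.
  move=> gx gz i.
  have gp U t : U \in ks -> x + t *: (z - x) \notin U.
    move=> Uk; have [->|t0] := eqVneq t 0; first by rewrite scale0r addr0 gx.
    apply: contra (gz U Uk) => pU.
    have -> : z = t^-1 *: (x + t *: (z - x)) + (1 - t^-1) *: x.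
      rewrite scalerDr scalerA mulVf// scale1r scalerBl scale1r.
      by rewrite addrAC (addrCA _ x) subrr addr0 addrC subrK.
    by rewrite memv_add// memvZ// memv_line.
  have H t0 t1 : F (x + t0 *: (z - x)) = M i (x + t0 *: (z - x)) ->
      F (x + t1 *: (z - x)) = M i (x + t1 *: (z - x)).
    move=> Ft0; have cT : connected [set: R] by apply/connected_intervalP.
    apply: (@connected_selection R _ _ _ (fun t => F (x + t *: (z - x)))
      (fun i t => M i (x + t *: (z - x))) cT _ _ _ i t0 t1 I Ft0 I).
    - have ME k t : M k (x + t *: (z - x)) = M k x + t *: M k (z - x).
        by rewrite linearD linearZ.
      by move=> k; under eq_set do rewrite ME; exact: closed_line_pieces pF.
    - by move=> t _; exact: sel.
    - move=> k l; have [->|nkl] := eqVneq (M k) (M l); [by left|right].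
      move=> t _ E; have /negP := gp _ t (ksP _ _ nkl); apply.
      by rewrite memv_ker add_lfunE opp_lfunE E subrr.
  have := H 0 1; have := H 1 0; rewrite scale0r addr0 scale1r [x + _]addrC subrK.
  by split.
have [i Fi] := sel x0; exists i => y.
have gen z : (forall U, U \in ks -> z \notin U) -> F z = M i z.
  move=> gz.
  (* The broken line from [x0] to [z] turns at [u]; the codimension hypothesis makes the subspaces
     to be avoided proper. *)
  have [U|u gu] := @notin_subspaces _ V
      ([seq (U + <[x0]>)%VS | U <- ks] ++ [seq (U + <[z]>)%VS | U <- ks]).
    by rewrite mem_cat => /orP[] /mapP[T /ks_cod Tk ->].
  apply/(seg z u gz) => [U Uk|].
    by apply: gu; rewrite mem_cat (map_f (fun U => (U + <[z]>)%VS)) ?orbT.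
  apply/(seg x0 u gx0) => // U Uk.
  by apply: gu; rewrite mem_cat (map_f (fun U => (U + <[x0]>)%VS)).
(* A point [y] of a kernel is a limit of generic points in direction [x0], since [x0] lies in no
   kernel. *)
pose S := [set t : R | F (y + t *: x0) = M i y + t *: M i x0].
have ST : S = setT.
  apply: closed_cofinite_setT; first exact: closed_line_pieces pF.
  apply: (@sub_finite_set _ _ (\bigcup_(U in [set` ks]) [set t | y + t *: x0 \in U])).
    move=> t; apply: contra_notP => nt; rewrite /S /= -linearZ -linearD; apply: gen.
    by move=> U Uk; apply/negP => yU; apply: nt; exists U.
  by apply: bigcup_finite => // U /gx0; exact: finite_line_subspace.
have : S 0 by rewrite ST.
by rewrite /S /= !scale0r !addr0.
Qed.

End Rigidity.
End PiecewiseLinearMaps.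

(** Translates of a neighbourhood of 1 show that the subgroup [H] and its complement are both open,
    so a connected set through 1 stays in [H]. *)
Lemma identity_component_subgroup (G : topologicalGroupType) (H : set G) :
  nbhs 1%g H -> (forall g h, H g -> H h -> H (g * h)%g) ->
  (forall g, H g -> H g^-1%g) -> identity_component G `<=` H.
Proof.
move=> H1 HM HV.
have transl h : nbhs h [set g | H (h^-1 * g)%g].
  have ch : (fun g => (h^-1 * g)%g) @ h --> (1%g : G).
    rewrite -(mulVg h); apply: (@cvg_comp _ _ _ (fun g => (h^-1%g, g))
      (fun p : G * G => (p.1 * p.2)%g) _ (nbhs (h^-1%g, h))).
      by apply: cvg_pair; [exact: cvg_cst|exact: cvg_id].
    exact: mulg_continuous (h^-1%g, h).
  exact: ch _ H1.
have oH : open H.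
  rewrite openE => h Hh; apply: filterS (transl h) => g /= Hg.
  by rewrite -(mulVKg h g); exact: HM.
have cH : closed H.
  rewrite -openC openE => h nHh; apply: filterS (transl h) => g /= Hg nHg.
  apply: nHh; suff -> : h = (g * (h^-1 * g)^-1)%g by apply: HM => //; exact: HV.
  by rewrite invgM invgK mulVKg.
move=> g [C [C1 _ cC] Cg].
suff CH : C `&` H = C by move: Cg; rewrite -[X in X _]CH => -[].
apply: cC; [|by exists H..].
by exists 1%g; split=> //; exact: nbhs_singleton H1.
Qed.

(** * Inner products and orthogonal complements *)

Section InnerProduct.
Variables (R : realType) (L : vectType R) (d : {dot L for idfun}).

Lemma dotC u v : d u v = d v u.
Proof. by rewrite hermC expr0 mul1r. Qed.

Lemma dotZl a u v : d (a *: u) v = a * d u v.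
Proof. by rewrite linearZl_LR. Qed.

Lemma dotZr a u v : d u (a *: v) = a * d u v.
Proof. by rewrite dotC dotZl dotC. Qed.

Lemma dot_eq0 u : d u u = 0 -> u = 0.
Proof.
move=> duu; apply/eqP/negP => /negP u0.
by have := @neq0_dnorm_gt0 _ _ _ d u u0; rewrite [X in 0 < X]duu ltxx.
Qed.

Lemma in_orthovP (U : {vspace L}) u :
  u \in orthov d U <-> forall v, v \in U -> d u v = 0.
Proof.
split=> [/mem_orthovP H v vU|H]; first exact: H.
by apply/mem_orthovP => v vU; exact: H.
Qed.

Lemma mem_orthov_self (U : {vspace L}) u : u \in U -> u \in orthov d U -> u = 0.
Proof. by move=> uU /in_orthovP /(_ u uU)/dot_eq0. Qed.

End InnerProduct.

(** * Consequences of continuity for the action of the identity component *)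

Section Representations.
Variables (R : realType) (G : topologicalGroupType).

Lemma rep_mulE (L : vectType R) (r : representation G L) g h v :
  r (g * h)%g v = r g (r h v).
Proof. by rewrite rhoM comp_lfunE. Qed.

Lemma rep_1E (L : vectType R) (r : representation G L) v : r 1%g v = v.
Proof. by rewrite rho1 id_lfunE. Qed.

Lemma rep_invK (L : vectType R) (r : representation G L) g v : r g^-1%g (r g v) = v.
Proof. by rewrite -rep_mulE mulVg rep_1E. Qed.

Lemma rep_eval_continuous (L : vectType R) (r : representation G L)
    (phi : 'Hom(L, R^o)) (v : L) :
  continuous (fun g => phi (r g v) : R).
Proof.
pose bL := vbasis {:L}.
pose T (A : 'M[R]_(\dim {:L})) : 'M[R]_1 := (phi (hommx bL bL A v))%:M.
have Tl : linear T.
  move=> a A B; rewrite /T (_ : hommx _ _ _ = a *: hommx bL bL A + hommx bL bL B).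
    by rewrite add_lfunE scale_lfunE linearP raddfD /= -scale_scalar_mx.
  exact: linearP.
pose TL := HB.pack_for {linear 'M[R]_(\dim {:L}) -> 'M[R]_1}
  T (GRing.isLinear.Build R _ _ _ T Tl).
have -> : (fun g => phi (r g v) : R) =
    (fun A : 'M[R]_1 => A 0 0) \o (TL \o (fun g => mxof bL bL (r g))).
  by apply/funext => g /=; rewrite /T mxofK ?vbasisP// mxE mulr1n.
move=> g; apply: continuous_comp; last exact: coord_continuous.
apply: continuous_comp; [exact: rho_continuous|exact: linear_mx_continuous].
Qed.

Lemma near_strictly_inside (L : vectType R) (r : representation G L) s (v : L) :
  strictly_inside s v -> \forall g \near (1%g : G), strictly_inside s (r g v).
Proof.
elim: s => [_|p s ih /= /andP[pv /ih{}ih]]; first exact: filterE.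
apply: filterS2 ih => [g rg sg|]; first by apply/andP; split; [exact: rg|].
apply: (cvgr_lt _ (@rep_eval_continuous _ r p.1 v 1%g)).
by rewrite rep_1E.
Qed.

Lemma equivariant_piece (L K : vectType R) (rL : representation G L)
    (rK : representation G K) (F : L -> K) s (M : 'Hom(L, K)) b x0 :
  equivariant rL rK F -> (forall x, inside s x -> F x = M x + b) ->
  strictly_inside s x0 ->
  forall g, identity_component G g ->
    (forall v, M (rL g v) = rK g (M v)) /\ rK g b = b.
Proof.
move=> eF FE sx0.
pose H := [set g | (forall v, M (rL g v) = rK g (M v)) /\ rK g b = b].
suff : identity_component G `<=` H by apply.
have nearF x : strictly_inside s x ->
    \forall g \near (1%g : G), M (rL g x) + b = rK g (M x + b).
  move=> sx; apply: filterS (near_strictly_inside rL sx) => g sgx.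
  by rewrite -!FE; [rewrite eF|exact: strictly_insideW..].
apply: identity_component_subgroup.
(* The affine identities at [x0] and at [x0 + t *: e], both strictly inside, are subtracted; the
   constant cancels and [t] is nonzero. *)
- have nearM e : \forall g \near (1%g : G), M (rL g e) = rK g (M e).
    have [t t0 st] := strictly_inside_line e sx0.
    apply: filterS2 (nearF _ sx0) (nearF _ st) => g E0 Et.
    move: Et; rewrite !linearD !linearZ /= addrAC [in RHS]addrAC.
    by rewrite E0 linearD => /addrI/(scalerI t0).
  (* The neighbourhood in [nearM] depends on [e]; a finite basis gives one that serves all
     vectors. *)
  have nearB : \forall g \near (1%g : G), forall i : 'I_(\dim {:L}),
      M (rL g (vbasis {:L})`_i) = rK g (M (vbasis {:L})`_i).
    by apply: filter_forall => i; exact: nearM.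
  apply: filterS2 nearB (nearF _ sx0) => g Mb E0.
  have Mg v : M (rL g v) = rK g (M v).
    rewrite (coord_vbasis (memvf v)) !linear_sum /=; apply: eq_bigr => i _.
    by rewrite !linearZ /= Mb.
  by split=> //; move: E0; rewrite linearD Mg => /addrI.
- move=> g h [Mg bg] [Mh bh]; split=> [v|]; rewrite !rep_mulE ?bh//.
  by rewrite Mg Mh.
- move=> g [Mg bg]; split=> [v|]; last by rewrite -{1}bg rep_invK.
  by rewrite -{2}[v](rep_invK rL g^-1%g) invgK Mg rep_invK.
Qed.

(** For nonzero [z] the action on the line is by a continuous scalar [chi], of square 1 because the
    inner product is invariant. As [chi] is 1 at the identity, the value -1 would force the value 0
    on the connected identity component. *)
Lemma rep_orbit_line (L : vectType R) (r : representation G L)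
    (d : {dot L for idfun}) (z : L) : dot_invariant r d ->
  (forall g, identity_component G g -> r g z \in <[z]>%VS) ->
  z \in fixv r (identity_component G).
Proof.
move=> inv st; apply/fixvP => h Gh.
have [->|z0] := eqVneq z 0; first by rewrite linear0.
have dz0 : d z z != 0 by apply: contraNneq z0 => /dot_eq0 ->.
pose phi : {linear L -> R^o} := GRing.Linear.clone _ _ _ _ (applyr d z) _.
pose chi g : R := d (r g z) z / d z z.
have rgz g : identity_component G g -> r g z = chi g *: z.
  move=> /st /vlineP[c rz]; by rewrite /chi rz dotZl mulfK.
have chi2 g : identity_component G g -> chi g ^+ 2 = 1.
  move=> /rgz rz; apply: (mulIf dz0); rewrite mul1r -[RHS](inv g) rz.
  by rewrite dotZl dotZr mulrA expr2.
have cchi : connected (chi @` identity_component G).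
  apply: connected_continuous_connected; first exact: component_connected.
  apply: continuous_subspaceT => g; apply: cvgM; last exact: cvg_cst.
  have := @rep_eval_continuous _ r (linfun phi) z g.
  by under eq_fun do rewrite lfunE.
have chi1 : (chi @` identity_component G) 1.
  exists 1%g; first exact: connected_component_refl.
  by rewrite /chi rep_1E divff.
have := chi2 _ Gh; move/eqP; rewrite sqrf_eq1 => /orP[/eqP h1|/eqP hN1].
  by rewrite rgz// h1 scale1r.
have chiN1 : (chi @` identity_component G) (-1) by exists h.
have [g Gg chig0] : (chi @` identity_component G) 0.
  by apply: (connected_intervalP _).1 cchi _ _ chiN1 chi1 _ _; rewrite lerN10 ler01.
by have := chi2 _ Gg; rewrite chig0 expr0n /= => /eqP; rewrite eq_sym oner_eq0.
Qed.

End Representations.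

(** * Orthogonal projections and the Riesz representation *)

Section Projection.
Variables (R : realType) (K : vectType R) (d : {dot K for idfun}).
Implicit Types (U : {vspace K}) (x : K).

Lemma orthproj_unique U u x :
  u \in U -> x - u \in orthov d U -> vsval (orthproj d U x) = u.
Proof.
move=> uU xu; apply/eqP; rewrite -subr_eq0; apply/eqP.
apply: (@mem_orthov_self _ _ d U); first by rewrite rpredB ?subvsP.
have -> : vsval (orthproj d U x) - u = (x - u) - (x - vsval (orthproj d U x)).
  by rewrite opprB [RHS]addrC addrA subrK.
by rewrite rpredB ?orthprojP.
Qed.

Lemma orthproj_orthov U x :
  vsval (orthproj d (orthov d U) x) = x - vsval (orthproj d U x).
Proof.
apply: orthproj_unique; first exact: orthprojP.
rewrite opprB addrC subrK; apply/in_orthovP => z /in_orthovP zU.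
by rewrite dotC zU ?subvsP.
Qed.

Lemma orthproj_val U (u : subvs_of U) : orthproj d U (vsval u) = u.
Proof. by apply: val_inj; apply: orthproj_unique; rewrite ?subvsP// subrr mem0v. Qed.

Lemma orthproj_of_orthov U x : x \in orthov d U -> orthproj d U x = 0.
Proof. by move=> xU; apply: val_inj; apply: orthproj_unique; rewrite ?mem0v ?subr0. Qed.

Lemma orthproj_of_orthovE U (u : subvs_of U) : orthproj d (orthov d U) (vsval u) = 0.
Proof. by apply: val_inj; rewrite /= orthproj_orthov orthproj_val subrr. Qed.

Definition orthprojf U : 'Hom(K, subvs_of U) :=
  (linfun (vsproj U) \o daddv_pi U (orthov d U))%VF.

Lemma orthprojfE U : orthprojf U = orthproj d U :> (K -> subvs_of U).
Proof. by apply/funext => x; rewrite comp_lfunE lfunE. Qed.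

Lemma orthproj_linear U : linear (orthproj d U).
Proof. by move=> a x y; rewrite -orthprojfE linearP. Qed.

(** The representing vector is a multiple of a normal [n] to the kernel: [x] minus
    [(lambda x / lambda n) *: n] lies in the kernel, hence is orthogonal to [n]. *)
Lemma riesz (lambda : 'Hom(K, R^o)) : exists v, forall x, lambda x = d x v.
Proof.
have [->|] := eqVneq lambda 0.
  by exists 0 => x; rewrite zero_lfunE dotC -(scale0r (0 : K)) dotZl mul0r.
move=> /eqP/lfunP/existsNP[x1]; rewrite zero_lfunE => /eqP l1.
pose n := x1 - vsval (orthproj d (lker lambda) x1).
have ln : lambda n = lambda x1.
  have /eqP l0 : lambda (vsval (orthproj d (lker lambda) x1)) == 0.
    by rewrite -memv_ker subvsP.
  by rewrite /n linearB /= l0 subr0.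
have dn : d n n != 0.
  by apply: contraNneq l1 => /dot_eq0 n0; rewrite -ln n0 linear0.
exists ((lambda n / d n n) *: n) => x; rewrite dotZr.
have : x - (lambda x / lambda n) *: n \in lker lambda.
  by rewrite memv_ker linearB linearZ /= -[_ *: _]/(_ * _) divfK ?subrr// ln.
move=> /((in_orthovP _ _ _).1 (orthprojP d (lker lambda) x1)).
rewrite -/n linearB /= dotZr => /eqP; rewrite subr_eq0 dotC => /eqP ->.
by rewrite mulrC mulrACA -mulrA mulrCA divff// mulr1 mulrC divfK// ln.
Qed.

End Projection.

(** * Splitting of equivariant piecewise linear maps *)

Section Representations.
Variables (R : realType) (G : topologicalGroupType).
Notation G0 := (identity_component G).

Lemma subrepE (L : vectType R) (r : representation G L) (V : {vspace L})
    (st : rep_stable r V) g v : vsval (subrep st g v) = r g (vsval v).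
Proof. by rewrite /= !comp_lfunE !lfunE/= vsprojK// st// subvsP. Qed.

Lemma orthproj_equivariant (L : vectType R) (r : representation G L)
    (d : {dot L for idfun}) (V : {vspace L}) (st : rep_stable r V) :
  dot_invariant r d -> equivariant r (subrep st) (orthproj d V).
Proof.
move=> inv g x; apply: val_inj; rewrite [LHS]subrepE; apply: esym; apply: orthproj_unique.
  by rewrite st ?subvsP.
by rewrite -linearB; apply: orthov_stable => //; exact: orthprojP.
Qed.

Lemma vsval_equivariant (L : vectType R) (r : representation G L)
    (V : {vspace L}) (st : rep_stable r V) : equivariant (subrep st) r vsval.
Proof. by move=> g x; rewrite subrepE. Qed.

Variables (L K : vectType R) (rL : representation G L) (rK : representation G K).
Variables (dL : {dot L for idfun}) (dK : {dot K for idfun}).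
Hypotheses (iL : dot_invariant rL dL) (iK : dot_invariant rK dK).
Notation V := (fixv rL G0).
Notation U := (fixv rK G0).
Notation W := (orthov dL V).
Notation Z := (orthov dK U).

Lemma commute_fixv (M : 'Hom(L, K)) v :
  (forall g, G0 g -> forall x, M (rL g x) = rK g (M x)) -> v \in V -> M v \in U.
Proof. by move=> MG /fixvP fv; apply/fixvP => g Gg; rewrite -MG ?fv. Qed.

(** The Riesz vector [v] of [x] mapped to [dK (M x) u] is the adjoint of [M] applied to [u].
    Invariance of both inner products and of [u] makes [v] fixed by [G0], so [v] lies in [V] and is
    orthogonal to [w]. *)
Lemma commute_orthov (M : 'Hom(L, K)) w :
  (forall g, G0 g -> forall x, M (rL g x) = rK g (M x)) -> w \in W -> M w \in Z.
Proof.
move=> MG wW; apply/in_orthovP => u /fixvP fu.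
have ll : linear (fun x => dK (M x) u : R^o).
  by move=> a x y; rewrite linearP linearPl.
pose lam := HB.pack_for {linear L -> R^o} (fun x => dK (M x) u : R^o)
  (GRing.isLinear.Build R _ _ _ _ ll).
have [v vP] := riesz dL (linfun lam).
have {}vP x : dK (M x) u = dL x v by rewrite -vP lfunE.
rewrite vP; apply: ((in_orthovP _ _ _).1 wW); apply/fixvP => g Gg.
have E y : dL (rL g y) (rL g v) = dL (rL g y) v.
  by rewrite iL -!vP MG// -{2}(fu g Gg) iK.
apply/eqP; rewrite -subr_eq0; apply/eqP/(dot_eq0 (d := dL)).
have {}E y : dL y (rL g v) = dL y v.
  by rewrite -(rep_invK rL g^-1%g y) invgK E.
by rewrite linearB /= E subrr.
Qed.

(* If the kernel had codimension 1, the image would be a line in [Z], on which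
   the connected group [G0] can only act trivially. *)
Lemma commute_codim (D : 'Hom(L, K)) x :
  (forall g, G0 g -> forall x, D (rL g x) = rK g (D x)) -> (forall x, D x \in Z) ->
  D != 0 -> (lker D + <[x]>)%VS != fullv.
Proof.
move=> DG DZ; apply: contra_neq => full.
have Dline y : D y \in <[D x]>%VS.
  have /memv_addP[k kD [_ /vlineP[c ->] ->]] : y \in (lker D + <[x]>)%VS by rewrite full memvf.
  by move: kD; rewrite memv_ker linearD linearZ /= => /eqP ->; rewrite add0r memvZ ?memv_line.
have Dx0 : D x = 0.
  apply: (@mem_orthov_self _ _ dK U) => //; apply: (rep_orbit_line iK) => g Gg.
  by rewrite -DG.
apply/lfunP => y; rewrite zero_lfunE; apply/eqP.
by move: (Dline y); rewrite Dx0 => /vlineP[c ->]; rewrite scaler0.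
Qed.

(** In effect the [U]-component of [F] factors through the projection to [V], and the [Z]-component
    is linear and factors through the projection to [W]. *)
Lemma equivariant_pl_split (F : L -> K) : equivariant rL rK F -> piecewise_linear F ->
  (forall x w, w \in W -> orthproj dK U (F (x + w)) = orthproj dK U (F x)) /\
  exists N : 'Hom(L, K), (forall x, vsval (orthproj dK Z (F x)) = N x) /\
    forall v, v \in V -> N v = 0.
Proof.
move=> eF /piecewise_linear_pieces[m [s0 [M0 [b0 /pl_pieces_fat[j [fat pF]]]]]].
set s := s0 \o j in pF; set M := M0 \o j in pF; set b := b0 \o j in pF.
have [_ _ FE] := pF.
have com i g : G0 g -> (forall v, M i (rL g v) = rK g (M i v)) /\ rK g (b i) = b i.
  by have [x sx] := fat i; apply: equivariant_piece eF (FE i) sx g.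
have comM i g : G0 g -> forall v, M i (rL g v) = rK g (M i v).
  by move=> /(com i)[].
have bU i : b i \in U by apply/fixvP => g /(com i)[].
split=> [x w wW|].
  rewrite -orthprojfE.
  apply: (@pl_pieces_const _ _ _ (orthprojf dK U \o F) _ _ _ _ x w (pl_pieces_lfun _ pF)).
  move=> i; rewrite comp_lfunE orthprojfE orthproj_of_orthov//; by apply: commute_orthov => //; exact: comM.
(* The projection to [Z] is taken as an endomorphism of [K], so that each [Q \o M i] intertwines the
   actions on [L] and [K]; it kills the constants [b i], which lie in [U]. *)
pose Q : 'End(K) := (linfun vsval \o orthprojf dK Z)%VF.
have QE x : Q x = vsval (orthproj dK Z x) by rewrite comp_lfunE lfunE orthprojfE.
have QU u : u \in U -> Q u = 0.
  by move=> uU; rewrite QE -(vsprojK uU) orthproj_of_orthovE.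
have Qcom g x : Q (rK g x) = rK g (Q x).
  rewrite !QE -(subrepE (orthov_stable iK (@fixv_stable _ _ _ rK))).
  by rewrite orthproj_equivariant.
pose N i := (Q \o M i)%VF.
have NE i x : N i x = Q (M i x) by exact: comp_lfunE.
have Ncom i g : G0 g -> forall x, N i (rL g x) = rK g (N i x).
  by move=> Gg x; rewrite !NE comM// Qcom.
have pN : pl_pieces (Q \o F) s N (fun=> 0).
  have -> : (fun=> 0) = Q \o b by apply/funext => i /=; rewrite QU.
  exact: pl_pieces_lfun.
have [i j' nij x|i Ni] := pl_pieces_linear pN.
  apply: commute_codim; last by rewrite subr_eq0.
    by move=> g Gg y; rewrite !add_lfunE !opp_lfunE !Ncom// linearB.
  by move=> y; rewrite add_lfunE opp_lfunE !NE !QE rpredB ?subvsP.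
exists (N i); split=> [x|v vV]; first by rewrite -QE -Ni.
by rewrite NE QU//; apply: commute_fixv => // g; exact: comM.
Qed.

End Representations.

(** * The isomorphism and its inverse *)

Theorem theorem2p5 (R : realType) (G : topologicalGroupType)
  (cG : compact [set: G]) (L K : vectType R)
  (rL : representation G L) (rK : representation G K)
  (dL : {dot L for idfun}) (dK : {dot K for idfun})
  (iL : dot_invariant rL dL) (iK : dot_invariant rK dK) :
  let G0 := identity_component G in
  let V := fixv rL G0 in
  let W := orthov dL V in
  let U := fixv rK G0 in
  let Z := orthov dK U in
  let rV := subrep (fixv_stable rL) in
  let rW := subrep (orthov_stable iL (fixv_stable rL)) in
  let rU := subrep (fixv_stable rK) in
  let rZ := subrep (orthov_stable iK (fixv_stable rK)) in
  exists Psi : {linear homPL rL rK -> (homPL rV rU * homG rW rZ)%type},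
    bijective Psi /\
    forall F : homPL rL rK,
      (forall v : subvs_of V, (Psi F).1 v = orthproj dK U (F (vsval v))) /\
      (forall w : subvs_of W, (Psi F).2 w = orthproj dK Z (F (vsval w))).
Proof.
move=> G0 V W U Z rV rW rU rZ.
have /choice[psi1 psi1P] : forall F : homPL rL rK, exists f : homPL rV rU,
    forall v : subvs_of V, f v = orthproj dK U (F (vsval v)).
  move=> F; have /asboolP[eF pF] := homPL_subproof F.
  have fP : (fun v : subvs_of V => orthproj dK U (F (vsval v))) \in equivariant_pl rV rU.
    apply/asboolP; split=> [g v|].
      by rewrite /rU orthproj_equivariant// eF /rV (vsval_equivariant (fixv_stable rL)).
    have -> : (fun v : subvs_of V => orthproj dK U (F (vsval v))) =
        (fun v => orthprojf dK U (F (linfun vsval v))).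
      by apply/funext => v; rewrite orthprojfE lfunE.
    exact: piecewise_linear_comp.
  by exists (HomPL fP).
have /choice[psi2 psi2P] : forall F : homPL rL rK, exists h : homG rW rZ,
    forall w : subvs_of W, h w = orthproj dK Z (F (vsval w)).
  move=> F; have /asboolP[eF pF] := homPL_subproof F.
  (* The second component is linear because the [Z]-component of [F] is the linear map [N]. *)
  have [_ [N [NE _]]] := equivariant_pl_split iL iK eF pF.
  pose h : 'Hom(subvs_of W, subvs_of Z) := (orthprojf dK Z \o N \o linfun vsval)%VF.
  have hE w : h w = orthproj dK Z (F (vsval w)).
    by rewrite 2!comp_lfunE orthprojfE lfunE -NE orthproj_val.
  have hP : h \in equivariant_linear rW rZ.
    apply/asboolP => g w; rewrite !hE /rZ orthproj_equivariant// eF /rW.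
    by rewrite (vsval_equivariant (orthov_stable iL (fixv_stable rL))).
  by exists (HomG hP).
(* The inverse extends [f] and [h] to [L] by the orthogonal projections and adds the results in
   [K]. *)
have /choice[phi phiP] : forall fh : homPL rV rU * homG rW rZ, exists F : homPL rL rK,
    forall x, F x = vsval (fh.1 (orthproj dL V x)) + vsval (fh.2 (orthproj dL W x)).
  move=> [f h]; have /asboolP[ef pf] := homPL_subproof f.
  have /asboolP eh := homG_subproof h.
  have FP : (fun x => vsval (f (orthproj dL V x)) + vsval (h (orthproj dL W x)))
      \in equivariant_pl rL rK.
    apply/asboolP; split=> [g x|].
      rewrite /= linearD /= -(subrepE (fixv_stable rK)) ef.
      rewrite -(subrepE (orthov_stable iK (fixv_stable rK))) eh.
      by rewrite !orthproj_equivariant.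
    have -> : (fun x => vsval (f (orthproj dL V x)) + vsval (h (orthproj dL W x))) =
        1 *: (fun x => linfun vsval (f (orthprojf dL V x))) +
        (linfun vsval \o h \o orthprojf dL W)%VF.
      by apply/funext => x; rewrite !fctE scale1r 2!comp_lfunE !orthprojfE !lfunE.
    apply: piecewise_linearP; [exact: piecewise_linear_comp|exact: piecewise_linear_lfun].
  by exists (HomPL FP).
pose psi F := (psi1 F, psi2 F).
have psi_linear : linear psi.
  move=> a F F'; congr pair.
    apply: val_inj; apply/funext => v.
    by rewrite [LHS]psi1P [LHS]orthproj_linear -!psi1P.
  apply: val_inj; apply/lfunP => w.
  by rewrite [LHS]psi2P [LHS]orthproj_linear -!psi2P add_lfunE scale_lfunE.
exists (HB.pack_for {linear homPL rL rK -> (homPL rV rU * homG rW rZ)%type} psi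
  (GRing.isLinear.Build R _ _ _ psi psi_linear)).
split; last by move=> F; split=> /=.
have hom0 (h : homG rW rZ) : h 0 = 0 by exact: linear0.
exists phi => [F|[f h]].
  have /asboolP[eF pF] := homPL_subproof F.
  have [FU [N [NE NV]]] := equivariant_pl_split iL iK eF pF.
  apply: val_inj; apply/funext => x; rewrite [LHS]phiP /= psi1P psi2P.
  have xE := orthproj_orthov dL V x.
  (* The [W]-part of [x] differs from [x] by its [V]-part, which [N] kills. *)
  have -> : orthproj dK Z (F (vsval (orthproj dL W x))) = orthproj dK Z (F x).
    apply: val_inj; rewrite /= !NE xE linearB /= [X in _ - X]NV ?subr0//.
    exact: subvsP.
  (* Adding the [W]-part of [x] to its [V]-part leaves the [U]-component of [F] unchanged, so both
     components are those of [F x]. *)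
  rewrite -(FU _ (vsval (orthproj dL W x))) ?subvsP// xE.
  by rewrite [_ + (x - _)]addrC subrK orthproj_orthov addrC subrK.
congr pair.
  apply: val_inj; apply/funext => v; rewrite [LHS]psi1P phiP /= orthproj_val.
  rewrite orthproj_of_orthovE hom0 linear0 addr0; exact: orthproj_val.
apply: val_inj; apply/lfunP => w; rewrite [LHS]psi2P phiP /= orthproj_val.
by rewrite -orthprojfE linearD /= orthprojfE orthproj_of_orthovE add0r orthproj_val.
Qed.
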